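(* Let $(r_0,r_1,\dots,r_T)\in[R]^{T+1}$ be a fixed observation sequence, let $\Gamma=\{\Gamma_1,\dots,\Gamma_p\}$ be a fixed partition of $[R]$ with membership function $\gamma:[R]\to[p]$, and let $S$ be fixed. Let $\mu=(\pi^R,\pi^S,A^R(\cdot),A^S(\cdot);\Gamma)\in\Lambda$. Then the unique maximizer $\mu'=M(\mu)=(\pi^{R'},\pi^{S'},A^{R'}(\cdot),A^{S'}(\cdot);\Gamma)$ of $Q(\mu,\cdot)$ over $\Lambda$ is given by $\pi^{R'}=e_{r_0}$ (the $r_0$-th canonical basis vector of $\mathbb{R}^R$) and $$\pi^{S'}_i=\frac{\sum_{j=1}^S\xi_1(i,j)}{\sum_{k=1}^S\alpha_T(k)},$$ $$a^{S'}_{ij}(l)=\frac{\sum_{t:\,\gamma(r_{t-1})=l}\xi_t(i,j)}{\sum_{k=1}^S\sum_{t:\,\gamma(r_{t-1})=l}\xi_t(i,k)},$$ $$a^{R'}_{mn}(i)=\frac{\sum_{k=1}^S\sum_{t:\,r_{t-1}=m,\,r_t=n}\xi_t(i,k)}{\sum_{\nu=1}^R\sum_{k=1}^S\sum_{t:\,r_{t-1}=m,\,r_t=\nu}\xi_t(i,k)},$$ for $i,j=1,\dots,S$, $l=1,\dots,p$, $m,n=1,\dots,R$, where in all sums $t$ ranges over $\{1,\dots,T\}$ subject to the indicated constraints.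
   Context: Notation: $[N]=\{1,\dots,N\}$. A matrix is row-stochastic if its entries are nonnegative and each row sums to $1$. A partition $\Gamma=\{\Gamma_1,\dots,\Gamma_p\}$ of $[R]$ defines $\gamma:[R]\to[p]$ by $\gamma(r)=k$ iff $r\in\Gamma_k$. A closed-loop Markov-modulated Markov chain (cl3MC) is a tuple $\mu=(\pi^R,\pi^S,A^R(\cdot),A^S(\cdot);\Gamma)$, where $\pi^R$ and $\pi^S$ are probability vectors on $[R]$ and $[S]$, $A^R(s)=(a^R_{mn}(s))$ is an $R\times R$ row-stochastic matrix for each $s\in[S]$, and $A^S(l)=(a^S_{ij}(l))$ is an $S\times S$ row-stochastic matrix for each $l\in[p]$. It describes a process $(S_t,R_t)_{t\ge0}$ on $[S]\times[R]$ with $S_0\sim\pi^S$, $R_0\sim\pi^R$ independent, and $$P(S_t=s',R_t=r'\mid S_{t-1}=s,R_{t-1}=r)=a^R_{rr'}(s)\,a^S_{ss'}(\gamma(r)).$$ $\Lambda$ denotes the set of all cl3MCs (with the given $R$, $S$, $\Gamma$). Joint probability of a latent sequence $(s_0,\dots,s_T)$ and the observed sequence: $$P(s_0,\dots,s_T,r_0,\dots,r_T\mid\mu)=\pi^R_{r_0}\pi^S_{s_0}\prod_{t=1}^T a^S_{s_{t-1}s_t}(\gamma(r_{t-1}))\,a^R_{r_{t-1}r_t}(s_{t-1}).$$ Auxiliary function: for $\mu,\mu'\in\Lambda$, $$Q(\mu,\mu')=\sum_{s_0,\dots,s_T\in[S]}P(s_0,\dots,s_T,r_0,\dots,r_T\mid\mu)\,\log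 P(s_0,\dots,s_T,r_0,\dots,r_T\mid\mu'),$$ with the convention $0\log 0=0$, and $Q(\mu,\mu')=-\infty$ if some latent sequence has $P(\cdot\mid\mu)>0$ and $P(\cdot\mid\mu')=0$. The forward variable is $\alpha_t(i)=P(S_t=i,R_0=r_0,\dots,R_t=r_t\mid\mu)$, so $\sum_{k=1}^S\alpha_T(k)=P(R_0=r_0,\dots,R_T=r_T\mid\mu)$ is the likelihood of $\mu$. For $t=1,\dots,T$, $$\xi_t(i,j)=P(S_{t-1}=i,S_t=j,R_0=r_0,\dots,R_T=r_T\mid\mu).$$
   Formalization: Uniqueness is stated for T ≥ 1 and all displayed denominators nonzero (otherwise formulas read 0/0 and rows are not determined); if only the likelihood is nonzero, the maximizers are exactly the cl3MCs agreeing with the formulas in every row with nonzero denominator. *)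

(* Defs.v *)
From HB Require Import structures.
From mathcomp Require Export all_boot all_order all_algebra.
From mathcomp Require Export all_classical all_reals all_analysis.
Export Order.TTheory GRing.Theory Num.Theory.

Set Implicit Arguments.
Unset Strict Implicit.
Unset Printing Implicit Defensive.

Local Open Scope ring_scope.

(* [N] = {1, ..., N} is represented by the 0-based type 'I_N. *)

(* Gamma_1, ..., Gamma_p are pairwise distinct and form a partition (in
   particular the blocks are nonempty) of [NR]. *)
Definition indexed_partition (NR p : nat) (Gam : 'I_p -> {set 'I_NR}) : Prop :=
  injective Gam /\ finset.partition [set Gam k | k : 'I_p] [set: 'I_NR].

Definition membership (NR p : nat) (Gam : 'I_p -> {set 'I_NR})
    (gam : 'I_NR -> 'I_p) : Prop :=
  forall r k, gam r = k <-> r \in Gam k.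

Definition prob_vector (K : realType) (n : nat) (v : 'rV[K]_n) : Prop :=
  (forall i, 0 <= v ord0 i) /\ \sum_i v ord0 i = 1.

Definition row_stochastic (K : realType) (n : nat) (A : 'M[K]_n) : Prop :=
  (forall i j, 0 <= A i j) /\ (forall i, \sum_j A i j = 1).

(* The raw parameters (pi^R, pi^S, A^R(.), A^S(.)); the partition is fixed
   throughout and enters the definitions below through gam. *)
Record params (K : realType) (NR NS p : nat) := Params {
  piR : 'rV[K]_NR ;
  piS : 'rV[K]_NS ;
  AR : 'I_NS -> 'M[K]_NR ;
  AS : 'I_p -> 'M[K]_NS }.

Definition cl3MC (K : realType) (NR NS p : nat) : set (params K NR NS p) :=
  [set mu | [/\ prob_vector (piR mu), prob_vector (piS mu),
                (forall s, row_stochastic (AR mu s)) &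
                (forall l, row_stochastic (AS mu l))]].

Section Process.
Context {K : realType} {NR NS p T : nat}.
Implicit Types (gam : 'I_NR -> 'I_p) (mu : params K NR NS p).
Implicit Types (s : {ffun 'I_T.+1 -> 'I_NS}) (r : {ffun 'I_T.+1 -> 'I_NR}).

(* Value at time t of a trajectory over the times 0, ..., T; only used for
   t <= T, where inord t is the ordinal of value t. *)
Definition at_time (N : nat) (w : {ffun 'I_T.+1 -> 'I_N}) (t : nat) : 'I_N :=
  w (inord t).

Definition joint_prob gam mu s r : K :=
  piR mu ord0 (at_time r 0) * piS mu ord0 (at_time s 0) *
  \prod_(1 <= t < T.+1)
    (AS mu (gam (at_time r t.-1)) (at_time s t.-1) (at_time s t) *
     AR mu (at_time s t.-1) (at_time r t.-1) (at_time r t)).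

(* Probability of an event under the law of the process (S_t, R_t) on the
   finite space of trajectories (S_0, R_0), ..., (S_T, R_T). *)
Definition Pr gam mu
    (E : {ffun 'I_T.+1 -> 'I_NS} -> {ffun 'I_T.+1 -> 'I_NR} -> bool) : K :=
  \sum_s \sum_(r | E s r) joint_prob gam mu s r.

(* The log-likelihood is taken in the extended reals: lne 0 = -oo, 0 * -oo = 0,
   and a sum with a term -oo (and no term +oo) is -oo. *)
Definition Qaux gam r mu mu' : \bar K :=
  (\sum_s (joint_prob gam mu s r)%:E * lne (joint_prob gam mu' s r)%:E)%E.

Definition is_maximizer gam r mu mu' : Prop :=
  cl3MC mu' /\ forall nu, cl3MC nu -> (Qaux gam r mu nu <= Qaux gam r mu mu')%E.

Definition alpha gam r mu (t : nat) (i : 'I_NS) : K :=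
  Pr gam mu (fun S R => (at_time S t == i) &&
    [forall u : 'I_T.+1, (u <= t)%N ==> (R u == r u)]).

Definition xi gam r mu (t : nat) (i j : 'I_NS) : K :=
  Pr gam mu (fun S R =>
    [&& at_time S t.-1 == i, at_time S t == j & R == r]).

Definition likelihood gam r mu : K := \sum_k alpha gam r mu T k.

Definition countS gam r mu (l : 'I_p) (i j : 'I_NS) : K :=
  \sum_(1 <= t < T.+1 | gam (at_time r t.-1) == l) xi gam r mu t i j.

Definition countR gam r mu (i : 'I_NS) (m n : 'I_NR) : K :=
  \sum_k \sum_(1 <= t < T.+1 | (at_time r t.-1 == m) && (at_time r t == n))
    xi gam r mu t i k.

Definition denS gam r mu (l : 'I_p) (i : 'I_NS) : K :=
  \sum_k countS gam r mu l i k.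

Definition denR gam r mu (i : 'I_NS) (m : 'I_NR) : K :=
  \sum_nu countR gam r mu i m nu.

(* Division by 0 gives 0 here, so an entry is meaningful only when its
   denominator is nonzero. *)
Definition reestimate gam r mu : params K NR NS p := {|
  piR := delta_mx ord0 (at_time r 0) ;
  piS := \row_i ((\sum_j xi gam r mu 1 i j) / likelihood gam r mu) ;
  AR := fun i => \matrix_(m, n) (countR gam r mu i m n / denR gam r mu i m) ;
  AS := fun l => \matrix_(i, j) (countS gam r mu l i j / denS gam r mu l i) |}.

Definition reestimate_defined gam r mu : Prop :=
  [/\ likelihood gam r mu != 0,
      (forall l i, denS gam r mu l i != 0) &
      (forall i m, denR gam r mu i m != 0)].

(* mu' agrees with the re-estimation formulas wherever their denominators are
   nonzero. *)
Definition agrees_where_defined gam r mu mu' : Prop :=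
  let M := reestimate gam r mu in
  [/\ piR mu' = piR M,
      likelihood gam r mu != 0 -> piS mu' = piS M,
      (forall l i, denS gam r mu l i != 0 ->
         row i (AS mu' l) = row i (AS M l)) &
      (forall i m, denR gam r mu i m != 0 ->
         row m (AR mu' i) = row m (AR M i))].

End Process.

(* Main.v *)
Require Import Defs.

Set Implicit Arguments.
Unset Strict Implicit.
Unset Printing Implicit Defensive.

(** The logarithm of a joint probability is the sum of the logarithms of its
    factors.  Weight this sum by the probability W(s), under mu, of the latent
    sequence s together with the observations, and collect the terms that
    contain the same parameter.  Then Q(mu, nu) becomes a sum of independent
    pieces (Qaux_weighted_log), one for each probability vector of nu: the two
    initial laws and every row of every transition matrix.  The piece of a
    vector q has the form sum_v c_v log q_v, where c_v >= 0 is the expected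
    number of uses of the entry v, up to the factor likelihood: the sums of xi
    in the re-estimation formulas are exactly these numbers.

    Since the pieces involve disjoint sets of parameters, each one can be
    maximized alone, and this is the Gibbs inequality: with C = sum_v c_v > 0,
    the tangent line bound log x <= x - 1 at x = q_v / (c_v / C) gives
    c_v log q_v <= c_v log (c_v / C) + (C q_v - c_v), and the last terms sum to
    C - C = 0 (gibbs).  The bound is strict unless x = 1, so only q = c / C
    attains the maximum (gibbs_eq).  When C = 0 the piece vanishes and q is
    free, which is why uniqueness needs nonzero denominators.

    All values lie in [-oo, 0], where sums and products by nonnegative reals
    distribute without restriction.  So the decomposition holds for every nu,
    including those with Q = -oo.  To conclude that a maximizer optimizes every
    piece, its value is compared with that of one chain which does: the
    re-estimate, completed by the rows of mu where the formulas read 0 / 0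
    (completed_reestimate).  There all pieces are finite, so equality of the
    sums forces equality of the pieces. *)

Local Open Scope ring_scope.

(* Simplification would otherwise replace the logarithm of a real by its
   case distinction on the sign. *)
Local Arguments lne : simpl never.

(** * Weighted logarithms and the Gibbs inequality *)

Section Gibbs.
Context {K : realType}.

Definition distribution {I : finType} (q : I -> K) : Prop :=
  (forall i, 0 <= q i) /\ \sum_i q i = 1.

Definition weighted_log {I : finType} (c q : I -> K) : \bar K :=
  (\sum_i (c i)%:E * lne (q i)%:E)%E.

(** The relative frequencies of the counts c are the only optimal law, except
    that every law is optimal when nothing was counted. *)
Definition fits {I : finType} (c q : I -> K) : Prop :=
  \sum_i c i != 0 -> forall i, q i = c i / \sum_j c j.

Lemma distribution_le1 {I : finType} (q : I -> K) :
  distribution q -> forall i, q i <= 1.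
Proof.
move=> [q0 <-] i; rewrite (bigD1 i) //= lerDl.
by apply: sumr_ge0.
Qed.

Lemma lne_distribution_le0 {I : finType} (q : I -> K) :
  distribution q -> forall i, (lne (q i)%:E <= 0)%E.
Proof. by move=> dq i; rewrite lne_le0 lee_fin; exact: distribution_le1. Qed.

Lemma lne0 : lne (0%:E : \bar K) = -oo%E.
Proof. by rewrite le0_lneNy. Qed.

(** The value -oo of the logarithm at 0 makes it additive on all nonnegative
    reals: no value +oo can meet it. *)
Lemma lne_mulr (x y : K) : 0 <= x -> 0 <= y ->
  lne (x * y)%:E = (lne x%:E + lne y%:E)%E.
Proof.
rewrite le_eqVlt => /predU1P[<- _|x0]; first by rewrite mul0r lne0.
rewrite le_eqVlt => /predU1P[<-|y0]; first by rewrite mulr0 lne0 addeNy.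
by rewrite EFinM lneM// in_itv/= lte_fin leey andbT.
Qed.

Lemma lne_prodr (I : Type) (s : seq I) (P : pred I) (f : I -> K) :
  (forall i, 0 <= f i) ->
  lne (\prod_(i <- s | P i) f i)%:E = (\sum_(i <- s | P i) lne (f i)%:E)%E.
Proof.
move=> f0; elim: s => [|i s IH]; first by rewrite !big_nil lne1.
rewrite !big_cons; case: (P i) => //.
by rewrite lne_mulr// ?IH// prodr_ge0.
Qed.

(** The Gibbs inequality one coordinate at a time: log x <= x - 1 for
    x = q / (c / C), multiplied by c.  The equality case survives here for
    c = 0 only because of the remainder C q. *)
Lemma weighted_log_tangent (c C q : K) : 0 <= c -> 0 < C -> 0 <= q ->
  (c%:E * lne q%:E <= c%:E * lne (c / C)%:E + (C * q - c)%:E)%E /\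
  ((c%:E * lne (c / C)%:E + (C * q - c)%:E <= c%:E * lne q%:E)%E -> q = c / C).
Proof.
move=> c0 C0 q0.
move: c0; rewrite le_eqVlt => /predU1P[<-|c0].
  rewrite !mul0e add0e subr0 mul0r !lee_fin; split; first by rewrite mulr_ge0 // ltW.
  by rewrite pmulr_rle0// => q_le0; apply/eqP; rewrite eq_le q_le0.
have p0 : 0 < c / C by rewrite divr_gt0.
move: q0; rewrite le_eqVlt => /predU1P[<-|q0].
  by rewrite lne0 gt0_muleNy ?lte_fin// leNye lne_EFin.
rewrite !lne_EFin// -!EFinM -EFinD !lee_fin.
set x := q / (c / C).
have x0 : 0 < x by rewrite divr_gt0.
have -> : q = x * (c / C) by rewrite divfK ?gt_eqF.
have -> : C * (x * (c / C)) - c = c * (x - 1).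
  by rewrite mulrBr mulr1 mulrCA [C * _]mulrC divfK ?gt_eqF// mulrC.
rewrite lnM// mulrDr addrC lerD2l ler_pM2l// lerD2l ler_pM2l//.
have lnx : x - 1 = expR (ln x) - 1 by rewrite lnK.
split; first by rewrite lnx lerBrDl expR_ge1Dx.
have [|lnx0] := eqVneq (ln x) 0.
  by move=> /eqP; rewrite ln_eq0// => /eqP -> _; rewrite mul1r.
by rewrite leNgt lnx ltrBrDl expR_gt1Dx.
Qed.

(** Finiteness of the upper bounds is essential: an infinite summand would hide
    a strict inequality in the other one. *)
Lemma leeD_squeeze (x1 x2 y1 y2 : \bar K) :
  y1 \is a fin_num -> y2 \is a fin_num -> (x1 <= y1)%E -> (x2 <= y2)%E ->
  (y1 + y2 <= x1 + x2)%E -> (y1 <= x1)%E /\ (y2 <= x2)%E.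
Proof.
move=> f1 f2 l1 l2 l; split.
  by rewrite -(leeD2rE _ _ f2) (le_trans l)// leeD2l.
by rewrite -(leeD2lE _ _ f1) (le_trans l)// leeD2r.
Qed.

Lemma lee_sum_squeeze {I : finType} (x y : I -> \bar K) :
  (forall i, y i \is a fin_num) -> (forall i, x i <= y i)%E ->
  (\sum_i y i <= \sum_i x i)%E -> forall i, (y i <= x i)%E.
Proof.
move=> fy lxy l i; move: l; rewrite (bigD1 i)//= [leRHS](bigD1 i)//=.
have fin_rest : (\sum_(j | j != i) y j)%E \is a fin_num by apply/sum_fin_numP.
by case/(leeD_squeeze (fy i) fin_rest (lxy i) (lee_sum _ (fun j _ => lxy j))).
Qed.

Section Counts.
Context {I : finType}.
Variable c : I -> K.
Hypothesis c_ge0 : forall i, 0 <= c i.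
Implicit Types q : I -> K.

Lemma weighted_log0 q : \sum_i c i = 0 -> weighted_log c q = 0%E.
Proof.
move=> sc0; rewrite /weighted_log big1// => i _.
by rewrite (psumr_eq0P _ sc0)// mul0e.
Qed.

Let C := \sum_i c i.

Let C_gt0 : C != 0 -> 0 < C.
Proof. by move=> C0; rewrite lt0r C0 sumr_ge0. Qed.

Lemma normalized_fin_num : C != 0 ->
  forall i, ((c i)%:E * lne (c i / C)%:E)%E \is a fin_num.
Proof.
move=> /C_gt0 C0 i; have := c_ge0 i; rewrite le_eqVlt => /predU1P[<-|ci0].
  by rewrite mul0e.
by rewrite lne_EFin ?divr_gt0.
Qed.

(** The remainders cancel because q and c / C have the same total mass. *)
Lemma sum_tangent_gap q : C != 0 -> distribution q ->
  (\sum_i ((c i)%:E * lne (c i / C)%:E + (C * q i - c i)%:E) =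
   \sum_i (c i)%:E * lne (c i / C)%:E)%E.
Proof.
move=> C0 [_ sq]; rewrite big_split/= sumEFin big_split/= -mulr_sumr sq mulr1.
by rewrite sumrN subrr adde0.
Qed.

Lemma gibbs q q' : distribution q -> fits c q' ->
  (weighted_log c q <= weighted_log c q')%E.
Proof.
move=> dq fq'; have [C0|C0] := eqVneq C 0; first by rewrite !weighted_log0.
rewrite [leRHS](eq_bigr (fun i => ((c i)%:E * lne (c i / C)%:E)%E)); last first.
  by move=> i _; rewrite fq'.
rewrite -(sum_tangent_gap C0 dq); apply: lee_sum => i _.
exact: (weighted_log_tangent (c_ge0 i) (C_gt0 C0) (dq.1 i)).1.
Qed.

Lemma weighted_log_fin_num q : fits c q -> weighted_log c q \is a fin_num.
Proof.
move=> fq; have [C0|C0] := eqVneq C 0; first by rewrite weighted_log0.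
by apply/sum_fin_numP => i _ _; rewrite fq//; exact: normalized_fin_num.
Qed.

(** The tangent bounds hold coordinatewise and are finite, so equality of the
    sums makes each of them an equality, which determines q coordinatewise. *)
Lemma gibbs_eq q q' : distribution q -> fits c q' ->
  (weighted_log c q' <= weighted_log c q)%E -> fits c q.
Proof.
move=> dq fq' le_q'q C0.
have tg i := weighted_log_tangent (c_ge0 i) (C_gt0 C0) (dq.1 i).
have fin_gap i : ((c i)%:E * lne (c i / C)%:E + (C * q i - c i)%:E)%E \is a fin_num.
  by rewrite fin_numD normalized_fin_num.
move=> i; apply: (tg i).2; apply: (lee_sum_squeeze fin_gap (fun j => (tg j).1)).
rewrite sum_tangent_gap//; apply: le_trans le_q'q.
by apply: lee_sum => j _; rewrite fq'.
Qed.

(** The fallback q, a law chosen beforehand, keeps this a law when the counts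
    vanish. *)
Definition normalize q i := if C != 0 then c i / C else q i.

Lemma normalize_distribution q : distribution q -> distribution (normalize q).
Proof.
rewrite /normalize => dq; have [C0|C0] := eqVneq C 0; first exact: dq.
split=> [i|].
  by apply: divr_ge0 => //; exact: sumr_ge0.
by rewrite -mulr_suml divff.
Qed.

Lemma normalize_fits q : fits c (normalize q).
Proof. by move=> C0 i; rewrite /normalize C0. Qed.

End Counts.

Section Tally.
Context {E V : finType}.
Variables (w : E -> K) (g : E -> V).

Definition tally v := \sum_(e | g e == v) w e.

Lemma sum_tally : \sum_v tally v = \sum_e w e.
Proof. by rewrite [RHS](partition_big g xpredT). Qed.

Hypothesis w_ge0 : forall e, 0 <= w e.

Lemma tally_ge0 v : 0 <= tally v.
Proof. exact: sumr_ge0. Qed.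

(** Collecting equal logarithms.  The weights may be added up even in front of
    an infinite logarithm because they are nonnegative. *)
Lemma weighted_log_tally (q : V -> K) :
  (\sum_e (w e)%:E * lne (q (g e))%:E)%E = weighted_log tally q.
Proof.
rewrite (partition_big g xpredT)//=; apply: eq_bigr => v _.
rewrite /tally -sumEFin ge0_sume_distrl => [|e _]; last by rewrite lee_fin.
by apply: eq_bigr => e /eqP ->.
Qed.

End Tally.

Lemma weighted_log_pair (I J : finType) (c q : I * J -> K) :
  weighted_log c q =
  (\sum_i weighted_log (fun j => c (i, j)) (fun j => q (i, j)))%E.
Proof. by rewrite /weighted_log pair_bigA; apply: eq_bigr => -[]. Qed.

End Gibbs.

(** * The auxiliary function as a sum of weighted logarithms *)

Section Auxiliary.
Context {K : realType} {NR NS p T : nat}.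
Variables (gam : 'I_NR -> 'I_p) (r : {ffun 'I_T.+1 -> 'I_NR}).
Variable mu : params K NR NS p.
Hypothesis mu_ok : cl3MC mu.
Implicit Types (s : {ffun 'I_T.+1 -> 'I_NS}) (nu : params K NR NS p).

Lemma cl3MC_distributions nu : cl3MC nu <->
  [/\ distribution (piR nu ord0), distribution (piS nu ord0),
    (forall i m, distribution (AR nu i m)) &
    (forall l i, distribution (AS nu l i))].
Proof.
split=> -[dR dS dAR dAS]; split=> // i.
- by move=> m; split=> [n|]; [apply: (dAR i).1 | apply: (dAR i).2].
- by move=> m; split=> [n|]; [apply: (dAS i).1 | apply: (dAS i).2].
- by split=> m; [apply: (dAR i m).1 | apply: (dAR i m).2].
- by split=> m; [apply: (dAS i m).1 | apply: (dAS i m).2].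
Qed.

Lemma joint_prob_ge0 nu s R : cl3MC nu -> 0 <= joint_prob gam nu s R.
Proof.
move=> /cl3MC_distributions[dR dS dAR dAS].
rewrite /joint_prob !mulr_ge0 ?dR.1 ?dS.1//.
by apply: prodr_ge0 => t _; rewrite mulr_ge0 ?(dAR _ _).1 ?(dAS _ _).1.
Qed.

Let W s := joint_prob gam mu s r.

Let W_ge0 s : 0 <= W s.
Proof. exact: joint_prob_ge0. Qed.

Definition initR := tally W (fun=> at_time r 0).
Definition initS := tally W (fun s => at_time s 0).

(** In xi the whole observed trajectory is prescribed, so that only the sum
    over the latent one is left. *)
Lemma xiE t i j : xi gam r mu t i j =
  \sum_(s | (at_time s t.-1 == i) && (at_time s t == j)) W s.
Proof.
rewrite /xi /Pr [RHS]big_mkcond; apply: eq_bigr => s _.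
case: (at_time s t.-1 == i) => /=; last by rewrite big_pred0.
case: (at_time s t == j) => /=; last by rewrite big_pred0.
by rewrite big_pred1_eq.
Qed.

Lemma likelihoodE : likelihood gam r mu = \sum_s W s.
Proof.
rewrite (partition_big (fun s => at_time s T) xpredT)//=; apply: eq_bigr => k _.
rewrite /alpha /Pr [RHS]big_mkcond; apply: eq_bigr => s _.
have eqR (R : {ffun 'I_T.+1 -> 'I_NR}) :
    [forall u : 'I_T.+1, (u <= T)%N ==> (R u == r u)] = (R == r).
  apply/forallP/eqP => [Rr|-> u]; last by rewrite eqxx implybT.
  by apply/ffunP => u; have := Rr u; rewrite -ltnS ltn_ord => /eqP.
under eq_bigl do rewrite eqR.
by case: (at_time s T == k) => /=; [rewrite big_pred1_eq | rewrite big_pred0].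
Qed.

(* Pairs (t, s) of a latent trajectory s and a transition of it, the one from
   time t to time t + 1; thus t is shifted by one from the time index of xi. *)
Let E := ('I_T * {ffun 'I_T.+1 -> 'I_NS})%type.
Let WE (e : E) := W e.2.

Definition transitionS (e : E) : 'I_p * 'I_NS * 'I_NS :=
  (gam (at_time r e.1), at_time e.2 e.1, at_time e.2 e.1.+1).
Definition transitionR (e : E) : 'I_NS * 'I_NR * 'I_NR :=
  (at_time e.2 e.1, at_time r e.1, at_time r e.1.+1).

Lemma countSE l i j : countS gam r mu l i j = tally WE transitionS (l, i, j).
Proof.
rewrite /countS big_add1 big_mkord /tally.
under eq_bigr do rewrite xiE.
rewrite pair_big_dep/=; apply: eq_bigl => -[t s].
by rewrite /transitionS !xpair_eqE/= andbA.
Qed.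

Lemma countRE i m n : countR gam r mu i m n = tally WE transitionR (i, m, n).
Proof.
rewrite /countR exchange_big/= big_add1 big_mkord /tally.
transitivity (\sum_(t < T | (at_time r t == m) && (at_time r t.+1 == n))
    \sum_(s | at_time s t == i) W s).
  apply: eq_bigr => t _; under eq_bigr do rewrite xiE.
  by rewrite [RHS](partition_big (fun s => at_time s t.+1) xpredT).
rewrite pair_big_dep/=; apply: eq_bigl => -[t s].
by rewrite /transitionR !xpair_eqE/= [LHS]andbC andbA.
Qed.

(** The time 1 exists, so the sum over the state at this time leaves the law of
    the state at time 0. *)
Lemma initSE i : (0 < T)%N -> initS i = \sum_j xi gam r mu 1 i j.
Proof.
move=> T0; rewrite /initS /tally (partition_big (fun s => at_time s 1) xpredT)//=.
by apply: eq_bigr => j _; rewrite xiE.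
Qed.

Lemma initRE n : initR n = if n == at_time r 0 then likelihood gam r mu else 0.
Proof.
rewrite /initR /tally likelihoodE eq_sym.
by case: ifP => nr; [apply: eq_bigl | rewrite big_pred0].
Qed.

(** The key decomposition: each parameter vector of nu appears in one summand
    only, so the summands can be maximized separately. *)
Lemma Qaux_weighted_log nu : cl3MC nu ->
  (Qaux gam r mu nu =
    weighted_log initR (piR nu ord0) + weighted_log initS (piS nu ord0) +
    \sum_(x : 'I_p * 'I_NS)
       weighted_log (countS gam r mu x.1 x.2) (AS nu x.1 x.2) +
    \sum_(x : 'I_NS * 'I_NR)
       weighted_log (countR gam r mu x.1 x.2) (AR nu x.1 x.2))%E.
Proof.
move=> /[dup] nu_ok /cl3MC_distributions[dR dS dAR dAS].
set qS := fun v : 'I_p * 'I_NS * 'I_NS => AS nu v.1.1 v.1.2 v.2.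
set qR := fun v : 'I_NS * 'I_NR * 'I_NR => AR nu v.1.1 v.1.2 v.2.
have lR0 := lne_distribution_le0 dR.
have lS0 := lne_distribution_le0 dS.
have lqS0 v : (lne (qS v)%:E <= 0)%E := lne_distribution_le0 (dAS _ _) _.
have lqR0 v : (lne (qR v)%:E <= 0)%E := lne_distribution_le0 (dAR _ _) _.
have lneW s : ((W s)%:E * lne (joint_prob gam nu s r)%:E =
    (W s)%:E * lne (piR nu ord0 (at_time r 0))%:E +
    (W s)%:E * lne (piS nu ord0 (at_time s 0))%:E +
    \sum_(t < T) (W s)%:E * lne (qS (transitionS (t, s)))%:E +
    \sum_(t < T) (W s)%:E * lne (qR (transitionR (t, s)))%:E)%E.
  rewrite /joint_prob big_add1 big_mkord/=.
  have tr0 (t : 'I_T) : 0 <= qS (transitionS (t, s)) * qR (transitionR (t, s)).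
    by rewrite mulr_ge0 ?(dAR _ _).1 ?(dAS _ _).1.
  rewrite lne_mulr; last 2 first.
  - by rewrite mulr_ge0 ?dR.1 ?dS.1.
  - by apply: prodr_ge0 => t _; exact: tr0.
  rewrite lne_mulr ?dR.1 ?dS.1// lne_prodr; last exact: tr0.
  have sS : (\sum_(t < T) lne (qS (transitionS (t, s)))%:E <= 0)%E.
    by apply: sume_le0 => t _; exact: lqS0.
  have sR : (\sum_(t < T) lne (qR (transitionR (t, s)))%:E <= 0)%E.
    by apply: sume_le0 => t _; exact: lqR0.
  rewrite (eq_bigr (fun t : 'I_T =>
    lne (qS (transitionS (t, s)))%:E + lne (qR (transitionR (t, s)))%:E)%E); last first.
    by move=> t _; rewrite lne_mulr ?(dAR _ _).1 ?(dAS _ _).1.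
  (* Logarithms of probabilities are nonpositive, so W s distributes over them
     even if some are infinite. *)
  rewrite big_split/= le0_muleDr ?adde_le0//.
  by rewrite le0_muleDr// le0_muleDr// !le0_sume_distrr// addeA.
rewrite /Qaux (eq_bigr _ (fun s _ => lneW s)) !big_split/=.
congr (_ + _ + _ + _)%E.
- exact: (weighted_log_tally (fun=> at_time r 0) W_ge0 (piR nu ord0)).
- exact: (weighted_log_tally (fun s => at_time s 0) W_ge0 (piS nu ord0)).
- rewrite exchange_big pair_bigA/=.
  rewrite (eq_bigr (fun e : E => ((WE e)%:E * lne (qS (transitionS e))%:E)%E)); last by case.
  rewrite (weighted_log_tally transitionS (fun e => W_ge0 e.2) qS) weighted_log_pair.
  by apply: eq_bigr => -[l i] _; apply: eq_bigr => j _; rewrite countSE.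
- rewrite exchange_big pair_bigA/=.
  rewrite (eq_bigr (fun e : E => ((WE e)%:E * lne (qR (transitionR e))%:E)%E)); last by case.
  rewrite (weighted_log_tally transitionR (fun e => W_ge0 e.2) qR) weighted_log_pair.
  by apply: eq_bigr => -[i m] _; apply: eq_bigr => n _; rewrite countRE.
Qed.

(** * Maximizers *)

Definition fits_counts nu : Prop :=
  [/\ fits initR (piR nu ord0), fits initS (piS nu ord0),
    (forall l i, fits (countS gam r mu l i) (AS nu l i)) &
    (forall i m, fits (countR gam r mu i m) (AR nu i m))].

Lemma countS_ge0 l i j : 0 <= countS gam r mu l i j.
Proof. by rewrite countSE tally_ge0// => e; exact: W_ge0. Qed.

Lemma countR_ge0 i m n : 0 <= countR gam r mu i m n.
Proof. by rewrite countRE tally_ge0// => e; exact: W_ge0. Qed.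

Lemma initR_ge0 n : 0 <= initR n.
Proof. exact: tally_ge0. Qed.

Lemma initS_ge0 i : 0 <= initS i.
Proof. exact: tally_ge0. Qed.

Lemma fits_counts_max nu nu' : cl3MC nu -> cl3MC nu' -> fits_counts nu' ->
  (Qaux gam r mu nu <= Qaux gam r mu nu')%E.
Proof.
move=> ok ok' [fR fS fAS fAR]; rewrite !Qaux_weighted_log//.
move: ok => /cl3MC_distributions[dR dS dAR dAS].
apply: leeD; [apply: leeD; [apply: leeD|]|].
- exact: gibbs initR_ge0 _ _ dR fR.
- exact: gibbs initS_ge0 _ _ dS fS.
- by apply: lee_sum => -[l i] _; exact: gibbs (countS_ge0 l i) _ _ (dAS l i) (fAS l i).
- by apply: lee_sum => -[i m] _; exact: gibbs (countR_ge0 i m) _ _ (dAR i m) (fAR i m).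
Qed.

(** Every summand of Q at nu is at most the finite summand at nu', so a sum that
    is not smaller leaves no gap in any summand. *)
Lemma max_fits_counts nu nu' : cl3MC nu -> cl3MC nu' -> fits_counts nu' ->
  (Qaux gam r mu nu' <= Qaux gam r mu nu)%E -> fits_counts nu.
Proof.
move=> ok ok' [fR fS fAS fAR]; rewrite !Qaux_weighted_log//.
move: ok => /cl3MC_distributions[dR dS dAR dAS].
have leR := gibbs initR_ge0 dR fR.
have leS := gibbs initS_ge0 dS fS.
have leAS x := gibbs (countS_ge0 x.1 x.2) (dAS x.1 x.2) (fAS x.1 x.2).
have leAR x := gibbs (countR_ge0 x.1 x.2) (dAR x.1 x.2) (fAR x.1 x.2).
have finR := weighted_log_fin_num initR_ge0 fR.
have finS := weighted_log_fin_num initS_ge0 fS.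
have finAS x := weighted_log_fin_num (countS_ge0 x.1 x.2) (fAS x.1 x.2).
have finAR x := weighted_log_fin_num (countR_ge0 x.1 x.2) (fAR x.1 x.2).
have fin_sum (I : finType) (f : I -> \bar K) :
  (forall x, f x \is a fin_num) -> (\sum_x f x)%E \is a fin_num.
  by move=> ff; apply/sum_fin_numP.
have finRS := etrans (fin_numD _ _) (introT andP (conj finR finS)).
have finRSS := etrans (fin_numD _ _) (introT andP (conj finRS (fin_sum _ _ finAS))).
have leSum (I : finType) (f g : I -> \bar K) :
    (forall x, f x <= g x)%E -> (\sum_x f x <= \sum_x g x)%E.
  by move=> lefg; exact: lee_sum.
case/(leeD_squeeze finRSS (fin_sum _ _ finAR)
       (leeD (leeD leR leS) (leSum _ _ _ leAS)) (leSum _ _ _ leAR)).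
case/(leeD_squeeze finRS (fin_sum _ _ finAS) (leeD leR leS) (leSum _ _ _ leAS)).
case/(leeD_squeeze finR finS leR leS) => geR geS.
move=> /(lee_sum_squeeze finAS leAS) geAS /(lee_sum_squeeze finAR leAR) geAR.
split=> [||l i|i m].
- exact: gibbs_eq initR_ge0 _ _ dR fR geR.
- exact: gibbs_eq initS_ge0 _ _ dS fS geS.
- exact: gibbs_eq (countS_ge0 l i) _ _ (dAS l i) (fAS l i) (geAS (l, i)).
- exact: gibbs_eq (countR_ge0 i m) _ _ (dAR i m) (fAR i m) (geAR (i, m)).
Qed.

(** A maximizer that exists without assumptions on the denominators: rows of mu
    replace the rows that the formulas leave undetermined. *)
Definition completed_reestimate : params K NR NS p := {|
  piR := \row_n normalize initR (piR mu ord0) n ;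
  piS := \row_i normalize initS (piS mu ord0) i ;
  AR := fun i =>
    \matrix_(m, n) normalize (countR gam r mu i m) (AR mu i m) n ;
  AS := fun l =>
    \matrix_(i, j) normalize (countS gam r mu l i) (AS mu l i) j |}.

Lemma completed_reestimate_ok :
  cl3MC completed_reestimate /\ fits_counts completed_reestimate.
Proof.
have eq_dist (I : finType) (q q' : I -> K) : q =1 q' -> distribution q -> distribution q'.
  by move=> qq' [q0 sq]; split=> [i|]; [rewrite -qq' | under eq_bigr do rewrite -qq'].
have /cl3MC_distributions[dR dS dAR dAS] := mu_ok.
split.
  apply/cl3MC_distributions; split=> [||i m|l i].
  - apply: eq_dist (normalize_distribution initR_ge0 dR) => n; by rewrite mxE.
  - apply: eq_dist (normalize_distribution initS_ge0 dS) => n; by rewrite mxE.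
  - apply: eq_dist (normalize_distribution (countR_ge0 i m) (dAR i m)) => n.
    by rewrite mxE.
  - apply: eq_dist (normalize_distribution (countS_ge0 l i) (dAS l i)) => n.
    by rewrite mxE.
by split=> [||l i|i m] C0 n; rewrite mxE normalize_fits.
Qed.

Lemma is_maximizerP nu :
  is_maximizer gam r mu nu <-> cl3MC nu /\ fits_counts nu.
Proof.
have [ok fit] := completed_reestimate_ok.
split=> [[nu_ok nu_max]|[nu_ok nu_fit]]; split=> //.
  exact: max_fits_counts nu_ok ok fit (nu_max _ ok).
by move=> nu' nu'_ok; exact: fits_counts_max.
Qed.

(** Both initial laws have the likelihood as total count, and the counts of the
    initial observation are concentrated at the observed one, hence the basis
    vector. *)
Lemma fits_countsP nu : (0 < T)%N -> likelihood gam r mu != 0 ->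
  fits_counts nu <-> agrees_where_defined gam r mu nu.
Proof.
move=> T0 L0.
have sR : \sum_n initR n = likelihood gam r mu by rewrite sum_tally likelihoodE.
have sS : \sum_i initS i = likelihood gam r mu by rewrite sum_tally likelihoodE.
have eR n : initR n / likelihood gam r mu = piR (reestimate gam r mu) ord0 n.
  by rewrite initRE !mxE eqxx/=; case: ifP; rewrite ?divff// mul0r.
split=> -[fR fS fAS fAR]; split=> [||l i|i m].
- by apply/rowP => n; rewrite fR sR// eR.
- by move=> _; apply/rowP => n; rewrite fS sS// mxE initSE.
- by move=> D0; apply/rowP => n; rewrite !mxE fAS.
- by move=> D0; apply/rowP => n; rewrite !mxE fAR.
- by move=> _ n; rewrite sR eR fR.
- by move=> _ n; rewrite sS fS// mxE initSE.
- by move=> D0 n; move/rowP/(_ n): (fAS l i D0); rewrite !mxE.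
- by move=> D0 n; move/rowP/(_ n): (fAR i m D0); rewrite !mxE.
Qed.

Lemma agrees_everywhere nu : reestimate_defined gam r mu ->
  agrees_where_defined gam r mu nu <-> reestimate gam r mu = nu.
Proof.
move=> [L0 dS dR]; split=> [|<-//].
case: nu => pR pS aR aS [/= -> eS eAS eAR].
rewrite eS// /reestimate; congr Params.
  by apply/funext => i; apply/row_matrixP => m; rewrite eAR.
by apply/funext => l; apply/row_matrixP => i; rewrite eAS.
Qed.

End Auxiliary.

Theorem theorem1 (K : realType) (NR NS p T : nat)
    (Gam : 'I_p -> {set 'I_NR}) (gam : 'I_NR -> 'I_p)
    (r : {ffun 'I_T.+1 -> 'I_NR}) (mu : params K NR NS p) :
  (0 < T)%N ->
  indexed_partition Gam ->
  membership Gam gam ->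
  cl3MC mu ->
  (reestimate_defined gam r mu ->
     unique (is_maximizer gam r mu) (reestimate gam r mu)) /\
  (likelihood gam r mu != 0%R ->
     forall mu' : params K NR NS p,
       is_maximizer gam r mu mu' <->
       cl3MC mu' /\ agrees_where_defined gam r mu mu').
Proof.
move=> T0 _ _ mu_ok.
have maxP nu : likelihood gam r mu != 0 ->
    is_maximizer gam r mu nu <-> cl3MC nu /\ agrees_where_defined gam r mu nu.
  move=> L0; have fitP := fits_countsP nu T0 L0.
  by split=> [/is_maximizerP-/(_ mu_ok)[ok /fitP]|[ok /fitP fit]] //; apply/is_maximizerP.
split=> [def|L0 mu']; last exact: maxP.
have [L0 _ _] := def.
have agree nu := agrees_everywhere nu def.
split=> [|nu /maxP-/(_ L0)[_ /agree]//].
have [ok fit] := completed_reestimate_ok gam r mu_ok.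
have /agree -> := (fits_countsP _ T0 L0).1 fit.
by apply/is_maximizerP.
Qed.
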